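(* The constrained minimum-cost inverse optimization problem $(S,\mathcal{F},F^*,\{c^j\}_{j\in[k]},\ell,u,\mathrm{H}_{\infty,w}(\cdot))$ with multiple cost functions under the weighted bottleneck Hamming distance objective can be solved using $O(k\cdot n)$ calls to the oracle $\mathcal{O}$, where $n=|S|$ and $k$ is the number of cost functions. That is, there is an algorithm which for every instance makes $O(k\cdot n)$ calls to $\mathcal{O}$ and outputs an optimal deviation vector, or reports that no feasible deviation vector exists.
   Context: An instance consists of: a finite ground set $S$ with $n=|S|$; a collection $\mathcal{F}\subseteq 2^S$ of feasible solutions of an underlying optimization problem; an input solution $F^*\in\mathcal{F}$; a positive integer $k$ and cost functions $c^1,\dots,c^k\in\mathbb{R}^S$, where $[k]=\{1,\dots,k\}$; a positive weight function $w\in\mathbb{R}_+^S$ (all $w(s)>0$); and bounds $\ell\colon S\to\mathbb{R}\cup\{-\infty\}$, $u\colon S\to\mathbb{R}\cup\{+\infty\}$ with $\ell\le u$. For $x\in\mathbb{R}^S$ and $X\subseteq S$, $x(X)=\sum_{s\in X}x(s)$. A deviation vector $p\in\mathbb{R}^S$ is feasible if (a) for every $j\in[k]$, $F^*$ is a minimum-cost member of $\mathcal{F}$ with respect to $c^j-p$, i.e. $(c^j-p)(F^* )\le (c^j-p)(F)$ for all $F\in\mathcal{F}$, and (b) $\ell\le p\le u$ coordinatewise. It is optimal if it is feasible and minimizes, among feasible deviation vectors, $\mathrm{H}_{\infty,w}(p)=\max\{w(s)\mid s\in S,\ p(s)\ne 0\}$, with the convention $\max\emptyset=-\infty$. The family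 $\mathcal{F}$ is accessed only through the oracle $\mathcal{O}$ (used as a black box), which, for any query $c'\in\mathbb{R}^S$, returns a member of $\mathcal{F}$ of minimum $c'$-cost; the other data are given explicitly. The algorithm is deterministic and may perform exact arithmetic and comparisons on real numbers. The constant in $O(k\cdot n)$ is absolute (independent of the instance). *)

(* Defs.v *)
From HB Require Import structures.
From mathcomp Require Import all_boot all_order all_algebra.
From mathcomp Require Import reals constructive_ereal.

Set Implicit Arguments.
Unset Strict Implicit.
Unset Printing Implicit Defensive.

Import Order.TTheory GRing.Theory Num.Theory.
Local Open Scope ring_scope.

Section InverseProblem.
Variables (R : realType) (S : finType).

Definition cost (c : {ffun S -> R}) (X : {set S}) : R := \sum_(s in X) c s.

Definition min_cost_member (F : {set {set S}}) (c : {ffun S -> R})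
    (X : {set S}) : Prop :=
  X \in F /\ forall Y, Y \in F -> cost c X <= cost c Y.

Definition min_cost_oracle (F : {set {set S}})
    (O : {ffun S -> R} -> {set S}) : Prop :=
  forall c, min_cost_member F c (O c).

Definition bottleneck_hamming (w p : {ffun S -> R}) : \bar R :=
  \big[Order.max/-oo%E]_(s | p s != 0) (w s)%:E.

Section Deviation.
Variables (F : {set {set S}}) (Fstar : {set S}) (k : nat).
Variables (c : 'I_k -> {ffun S -> R}) (w : {ffun S -> R}) (l u : S -> \bar R).

Definition feasible_deviation (p : {ffun S -> R}) : Prop :=
  (forall j, min_cost_member F (c j - p) Fstar) /\
  (forall s, (l s <= (p s)%:E <= u s)%E).

Definition optimal_deviation (p : {ffun S -> R}) : Prop :=
  feasible_deviation p /\
  forall q, feasible_deviation q ->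
    (bottleneck_hamming w p <= bottleneck_hamming w q)%E.

(* [None] is the report that no feasible deviation vector exists. *)
Definition correct_output (out : option {ffun S -> R}) : Prop :=
  if out is Some p then optimal_deviation p
  else ~ exists p, feasible_deviation p.

End Deviation.
End InverseProblem.

(* Algorithms are while-programs of a real random access machine with an
   oracle instruction.  The machine has registers [0, 1, 2, ...] holding
   natural numbers, and real cells indexed by a row and a column, both of which
   may be computed at run time from the registers.  The syntax contains no real
   number other than natural number constants and does not mention the instance,
   so that one program has to serve all instances of all sizes. *)

Inductive nexp : Type :=
| NConst of nat
| NReg of nat
| NAdd of nexp & nexp
| NSub of nexp & nexp
| NMul of nexp & nexp.

Inductive rexp : Type :=
| RConst of nat
| RCell of nexp & nexp
| RAdd of rexp & rexp
| RSub of rexp & rexp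
| RMul of rexp & rexp
| RDiv of rexp & rexp.

Inductive bexp : Type :=
| BLtN of nexp & nexp
| BLtR of rexp & rexp
| BNot of bexp
| BAnd of bexp & bexp.

Inductive program : Type :=
| Skip
| SetReg of nat & nexp
| SetCell of nexp & nexp & rexp
| Seq of program & program
| If of bexp & program & program
| While of bexp & program
| Ask of nexp.

Section Semantics.
Variable R : realType.

Record state := State {
  reg : nat -> nat;
  cell : nat -> nat -> R
}.

Fixpoint neval (st : state) (e : nexp) : nat :=
  match e with
  | NConst m => m
  | NReg i => reg st i
  | NAdd e1 e2 => (neval st e1 + neval st e2)%N
  | NSub e1 e2 => (neval st e1 - neval st e2)%N
  | NMul e1 e2 => (neval st e1 * neval st e2)%N
  end.

Fixpoint reval (st : state) (e : rexp) : R :=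
  match e with
  | RConst m => m%:R
  | RCell e1 e2 => cell st (neval st e1) (neval st e2)
  | RAdd e1 e2 => reval st e1 + reval st e2
  | RSub e1 e2 => reval st e1 - reval st e2
  | RMul e1 e2 => reval st e1 * reval st e2
  | RDiv e1 e2 => reval st e1 / reval st e2
  end.

Fixpoint beval (st : state) (e : bexp) : bool :=
  match e with
  | BLtN e1 e2 => (neval st e1 < neval st e2)%N
  | BLtR e1 e2 => reval st e1 < reval st e2
  | BNot e1 => ~~ beval st e1
  | BAnd e1 e2 => beval st e1 && beval st e2
  end.

Definition set_reg (st : state) (i m : nat) : state :=
  State [eta reg st with i |-> m] (cell st).

Definition set_row (st : state) (a : nat) (r : nat -> R) : state :=
  State (reg st) [eta cell st with a |-> r].

Definition set_cell (st : state) (a i : nat) (x : R) : state :=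
  set_row st a [eta cell st a with i |-> x].

Variable S : finType.

(* A vector indexed by [S] occupies the first [#|S|] cells of a row, in the
   order of the enumeration of [S]. *)
Definition row_of (f : S -> R) : nat -> R :=
  fun i => if @insub nat (fun i => i < #|S|)%N 'I_#|S| i is Some r
           then f (enum_val r) else 0.

Definition vec_of (r : nat -> R) : {ffun S -> R} :=
  [ffun s => r (enum_rank s)].

Definition indicator (P : pred S) : S -> R := fun s => (P s)%:R.

(* [exec O P st q st']: started in [st], the program [P] halts in [st'] after
   exactly [q] oracle calls.  [Ask e] submits the vector stored in row [e] and
   overwrites that row with the incidence vector of the answer; this is the only
   instruction whose effect depends on [O]. *)
Inductive exec (O : {ffun S -> R} -> {set S}) :
    program -> state -> nat -> state -> Prop :=
| exec_skip st : exec O Skip st 0 st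
| exec_set_reg st i e :
    exec O (SetReg i e) st 0 (set_reg st i (neval st e))
| exec_set_cell st e1 e2 e :
    exec O (SetCell e1 e2 e) st 0
      (set_cell st (neval st e1) (neval st e2) (reval st e))
| exec_seq P1 P2 st1 st2 st3 q1 q2 :
    exec O P1 st1 q1 st2 -> exec O P2 st2 q2 st3 ->
    exec O (Seq P1 P2) st1 (q1 + q2) st3
| exec_if b P1 P2 st q st' :
    exec O (if beval st b then P1 else P2) st q st' ->
    exec O (If b P1 P2) st q st'
| exec_while_false b P st :
    ~~ beval st b -> exec O (While b P) st 0 st
| exec_while_true b P st1 st2 st3 q1 q2 :
    beval st1 b -> exec O P st1 q1 st2 -> exec O (While b P) st2 q2 st3 ->
    exec O (While b P) st1 (q1 + q2) st3
| exec_ask e st :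
    exec O (Ask e) st 1
      (set_row st (neval st e)
         (row_of (indicator (mem (O (vec_of (cell st (neval st e)))))))).

(* The input contains no information on the family of feasible solutions other
   than [Fstar].  Registers 0 and 1 hold [#|S|] and [k].  A bound is given by
   two rows: whether it is finite, and its value ([fine] is 0 at infinities). *)
Definition input (Fstar : {set S}) (k : nat) (c : 'I_k -> {ffun S -> R})
    (w : {ffun S -> R}) (l u : S -> \bar R) : state :=
  State (nth 0%N [:: #|S|; k])
    (fun a => match a with
     | 0 => row_of (indicator (mem Fstar))
     | 1 => row_of w
     | 2 => row_of (indicator (fun s => l s \is a fin_num))
     | 3 => row_of (fun s => fine (l s))
     | 4 => row_of (indicator (fun s => u s \is a fin_num))
     | 5 => row_of (fun s => fine (u s))
     | j.+4.+2 => if @insub nat (fun j => j < k)%N 'I_k j is Some j'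
               then row_of (c j') else fun=> 0
     end).

(* On halting, register 0 tells whether a vector is output; it is in row 0. *)
Definition output (st : state) : option {ffun S -> R} :=
  if reg st 0 == 0%N then None else Some (vec_of (cell st 0)).

Lemma exec_deterministic O P st q1 st1 q2 st2 :
  exec O P st q1 st1 -> exec O P st q2 st2 -> q1 = q2 /\ st1 = st2.
Proof.
move=> E; elim: E q2 st2 => {P st q1 st1}.
- by move=> st q2 st2 E2; inversion E2.
- by move=> st i e q2 st2 E2; inversion E2.
- by move=> st e1 e2 e q2 st2 E2; inversion E2.
- move=> P1 P2 s1 s2 s3 q1 q1' _ IH1 _ IH2 q2 st2 E2.
  inversion E2 as [| | |A B C D G I J K L| | | |]; subst.
  by case: (IH1 _ _ K) => ? ?; subst; case: (IH2 _ _ L) => ? ?; subst.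
- by move=> b P1 P2 st q st' _ IH q2 st2 E2; inversion E2; subst; apply: IH.
- by move=> b P st /negP nb q2 st2 E2; inversion E2.
- move=> b P s1 s2 s3 q1 q1' hb _ IH1 _ IH2 q2 st2 E2.
  inversion E2 as [| | | | |A B C D|A B C D G I J K L M|]; subst.
    by rewrite hb in D.
  by case: (IH1 _ _ L) => ? ?; subst; case: (IH2 _ _ M) => ? ?; subst.
- by move=> e st q2 st2 E2; inversion E2.
Qed.

End Semantics.

(* Main.v *)
Require Import Defs.
From HB Require Import structures.
From mathcomp Require Import all_boot all_order all_algebra.
From mathcomp Require Import reals constructive_ereal.
From mathcomp Require Import lra.

Set Implicit Arguments.
Unset Strict Implicit.
Unset Printing Implicit Defensive.

Import Order.TTheory GRing.Theory Num.Theory.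
Local Open Scope ring_scope.

(** Fix a threshold [d] and let only the elements of weight at most [d] carry a
deviation.  The best that such a deviation can do is to make [Fstar] as cheap
as possible: push [p s] up to its upper bound on [Fstar] and down to its lower
bound elsewhere.  Where that bound is infinite, a large number [bigM] stands in
for it.  The resulting vector [candidate d] is feasible as soon as some
feasible deviation is supported on the elements of weight at most [d]
([candidate_feasible]): compared with that deviation, every term of
[cost (c j - p) Fstar - cost (c j - p) Y] can only decrease, unless an infinite
bound is involved, and then one occurrence of [bigM] outweighs all the other
terms together.  Since [bigM] is an explicit polynomial in the costs and the
finite bounds, it can be computed without any knowledge of the family.

Hence an optimal deviation is found among the candidates whose threshold is a
weight, together with one candidate for the empty support.  The latter gets the
threshold [0], because weights are positive; conveniently, [0] is the content
of the weight row just after its last entry, so the thresholds are the entries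
[0], ..., [#|S|] of that row ([threshold_exists]).  Feasibility of one
candidate is a condition on the bounds and one oracle call per cost function
([feasible_candidateP]), and the feasible candidate with the least threshold is
optimal.  In total this takes [(#|S| + 1) * k] calls, at most [2 * (k * #|S|)]
if the ground set is nonempty; on the empty ground set the only deviation is
optimal and no call is affordable, so that case is treated apart.

The other half of the proof is the verification of a program doing this.
[runs] is a weakest-precondition form of total correctness with a bound on the
number of calls, [frame] records what a piece of code leaves untouched, and
[runs_for] is the invariant rule for counting loops, with invariants indexed by
the list of elements already visited, so that partial sums and partially
filled rows are expressed without index arithmetic.  *)

(** * Candidate deviations *)

Section Candidates.
Variables (R : realType) (S : finType).

Lemma cost_diff (a : {ffun S -> R}) (X Y : {set S}) :
  cost a X - cost a Y = \sum_s ((s \in X)%:R - (s \in Y)%:R) * a s.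
Proof.
rewrite /cost !(big_mkcond (fun s => s \in _)) -sumrB; apply: eq_bigr => s _ /=.
by case: (s \in X); case: (s \in Y) => /=; lra.
Qed.

(** Replaces absolute values, which the machine cannot form without branching,
by squares in the definition of the large constant. *)
Lemma normr_le_sqr1 (x : R) : `|x| <= x * x + 1 / 4.
Proof.
have : 0 <= (`|x| - 1 / 2) * (`|x| - 1 / 2) by rewrite -expr2 sqr_ge0.
have -> : x * x = `|x| * `|x| by rewrite -normrM ger0_norm // -expr2 sqr_ge0.
by lra.
Qed.

Variables (F : {set {set S}}) (Fstar : {set S}) (k : nat).
Variables (c : 'I_k -> {ffun S -> R}) (w : {ffun S -> R}) (l u : S -> \bar R).
Hypothesis Fstar_in : Fstar \in F.
Hypothesis k_gt0 : (0 < k)%N.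
Hypothesis w_gt0 : forall s, 0 < w s.
Hypothesis l_lty : forall s, l s != +oo%E.
Hypothesis u_gtNy : forall s, u s != -oo%E.
Hypothesis l_le_u : forall s, (l s <= u s)%E.

Definition size_term (j : 'I_k) (s : S) : R :=
  c j s * c j s + (fine (l s) * fine (l s) + (fine (u s) * fine (u s) + 1)).

Definition bigM : R := \sum_j \sum_s size_term j s.

Lemma size_term_ge j s :
  `|c j s| + `|fine (l s)| + `|fine (u s)| <= size_term j s.
Proof.
rewrite /size_term; move: (normr_le_sqr1 (c j s)) (normr_le_sqr1 (fine (l s))).
by move: (normr_le_sqr1 (fine (u s))); lra.
Qed.

Lemma size_term_ge0 j s : 0 <= size_term j s.
Proof. by apply: le_trans (size_term_ge j s); rewrite !addr_ge0. Qed.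

Lemma bigM_ge_sum j :
  \sum_s (`|c j s| + `|fine (l s)| + `|fine (u s)|) <= bigM.
Proof.
apply: (@le_trans _ _ (\sum_s size_term j s)).
  by apply: ler_sum => s _; apply: size_term_ge.
rewrite /bigM (bigD1 j) //= lerDl; apply: sumr_ge0 => i _.
by apply: sumr_ge0 => s _; apply: size_term_ge0.
Qed.

Lemma bigM_ge s : `|fine (l s)| + `|fine (u s)| <= bigM.
Proof.
apply: le_trans (bigM_ge_sum (Ordinal k_gt0)).
rewrite (bigD1 s) //=.
have : 0 <= \sum_(i | i != s)
    (`|c (Ordinal k_gt0) i| + `|fine (l i)| + `|fine (u i)|).
  by apply: sumr_ge0 => i _; rewrite !addr_ge0.
have := normr_ge0 (c (Ordinal k_gt0) s); lra.
Qed.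

Definition extreme (s : S) : R :=
  if s \in Fstar then if u s \is a fin_num then fine (u s) else bigM
  else if l s \is a fin_num then fine (l s) else - bigM.

(** Where the large constant replaces an infinite bound, it still has to respect
a finite bound on the other side: this is one reason why the bounds enter
[bigM]. *)
Lemma extreme_bounds s : (l s <= (extreme s)%:E <= u s)%E.
Proof.
have := ler_norm (fine (u s)); have := ler_norm (fine (l s)).
have := ler_norm (- fine (u s)); have := ler_norm (- fine (l s)).
have := normr_ge0 (fine (u s)); have := normr_ge0 (fine (l s)); rewrite !normrN.
move: (bigM_ge s) (l_lty s) (u_gtNy s) (l_le_u s); rewrite /extreme.
case: (l s) => [a||] //; case: (u s) => [b||] //= M_ge _ _;
  case: (s \in Fstar); rewrite /= ?lee_fin ?lexx ?leey ?leNye //= => ab;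
  rewrite ?ab ?andbT //; lra.
Qed.

Definition candidate (d : R) : {ffun S -> R} :=
  [ffun s => if d < w s then 0 else extreme s].

(** Membership of [0] in the interval of bounds, phrased without testing the
bounds for finiteness: [fine] is [0] at infinities, and the infinite lower
(upper) bound can only be minus (plus) infinity. *)
Definition zero_in_bounds (s : S) : bool :=
  ~~ (0 < fine (l s)) && ~~ (fine (u s) < 0).

Lemma zero_in_boundsP s : (l s <= 0%:E <= u s)%E = zero_in_bounds s.
Proof.
rewrite /zero_in_bounds -!leNgt; move: (l_lty s) (u_gtNy s).
by case: (l s) => [a||] //; case: (u s) => [b||] //= _ _;
  rewrite ?lee_fin ?leey ?leNye ?lexx.
Qed.

(** Among the deviations supported on the elements of weight at most [d], the
candidate favours [Fstar] the most against every competitor [Y]. *)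
Lemma candidate_feasible d q :
  feasible_deviation F Fstar c l u q -> (forall s, d < w s -> q s = 0) ->
  feasible_deviation F Fstar c l u (candidate d).
Proof.
move=> [q_min q_lu] q0; split; last first.
  move=> s; rewrite ffunE; case: ifP => [dw|_]; last exact: extreme_bounds.
  by rewrite -(q0 _ dw).
move=> j; split => // Y YF.
rewrite -subr_le0 cost_diff.
pose x s : R := (s \in Fstar)%:R - (s \in Y)%:R.
(* Elements at which the large constant replaces an infinite bound. *)
pose big s :=
  if s \in Fstar then u s \isn't a fin_num else l s \isn't a fin_num.
case: (pickP (fun s => [&& ~~ (d < w s), big s & (s \in Fstar) != (s \in Y)])).
  (* The constant occurs on [s0], where [Fstar] and [Y] differ: it alone pays
     for all the other terms. *)
  move=> s0 /and3P[/negPf dw0 big0 x0].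
  pose B s := `|c j s| + `|fine (l s)| + `|fine (u s)|.
  have term_le s : x s * (c j - candidate d) s <= B s.
    have M0 : 0 <= bigM by apply: le_trans (bigM_ge s); rewrite addr_ge0.
    rewrite /x /B !ffunE /extreme.
    have := ler_norm (c j s); have := ler_norm (- c j s).
    have := ler_norm (fine (l s)); have := ler_norm (- fine (u s)).
    rewrite !normrN.
    have := normr_ge0 (fine (l s)); have := normr_ge0 (fine (u s)).
    case: (d < w s); case: (s \in Fstar); case: (s \in Y);
     case: (u s \is a fin_num); case: (l s \is a fin_num); rewrite /=; lra.
  have term0 : x s0 * (c j - candidate d) s0 <= B s0 - bigM.
    move: big0 x0; rewrite /big /x /B !ffunE /extreme dw0.
    have := ler_norm (c j s0); have := ler_norm (- c j s0); rewrite normrN.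
    have := normr_ge0 (fine (l s0)); have := normr_ge0 (fine (u s0)).
    by case: (s0 \in Fstar); case: (s0 \in Y) => //=;
      move=> ? ? ? ? /negPf -> _; lra.
  have := bigM_ge_sum j; rewrite (bigD1 s0) //= -/(B s0) => M_ge.
  rewrite (bigD1 s0) //=.
  have : \sum_(i | i != s0) x i * (c j - candidate d) i
      <= \sum_(i | i != s0) B i.
    by apply: ler_sum => i _; apply: term_le.
  by move: M_ge term0; rewrite /B /x; lra.
(* Otherwise the comparison with [q] holds term by term. *)
move=> no_big; have [_ /(_ Y YF)] := q_min j.
rewrite -subr_le0 cost_diff; apply: le_trans; apply: ler_sum => s _.
have := no_big s; rewrite !ffunE /big /extreme.
case: (ifP (d < w s)) => [dw _|_] /=; first by rewrite (q0 _ dw).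
have := q_lu s; have := l_lty s; have := u_gtNy s.
case: (s \in Fstar); case: (s \in Y); rewrite /= ?andbT ?andbF;
  case: (l s) => [a||]; case: (u s) => [b||] //=; rewrite ?lee_fin;
  move=> _ _ /andP[? ?] _; lra.
Qed.

(** One oracle answer decides optimality of [Fstar] for one cost function, as
the answer is a cheapest competitor. *)
Lemma feasible_candidateP O d : min_cost_oracle F O ->
  feasible_deviation F Fstar c l u (candidate d) <->
  (forall s, d < w s -> zero_in_bounds s) /\
  (forall j, cost (c j - candidate d) Fstar
             <= cost (c j - candidate d) (O (c j - candidate d))).
Proof.
move=> oracle; split=> [[mins lu]|[zeros mins]]; split.
- by move=> s dw; rewrite -zero_in_boundsP; have := lu s; rewrite ffunE dw.
- by move=> j; apply: (mins j).2; apply: (oracle _).1.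
- move=> j; split=> // Y YF; apply: le_trans (mins j) _.
  exact: (oracle _).2.
- move=> s; rewrite ffunE; case: ifP => [dw|_]; last exact: extreme_bounds.
  by rewrite zero_in_boundsP zeros.
Qed.

Lemma row_of_rank (f : S -> R) s : row_of f (enum_rank s) = f s.
Proof. by rewrite /row_of valK enum_rankK. Qed.

Lemma row_of_default (f : S -> R) i : (#|S| <= i)%N -> row_of f i = 0.
Proof. by rewrite /row_of => Si; rewrite insubF // ltnNge Si. Qed.

(** The thresholds suffice: for a feasible [q], take the largest weight in its
support, or the default [0] beyond the weights if [q] is zero. *)
Lemma threshold_exists q : feasible_deviation F Fstar c l u q ->
  exists i, [/\ (i <= #|S|)%N,
    feasible_deviation F Fstar c l u (candidate (row_of w i)) &
    forall d, d <= row_of w i ->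
     (bottleneck_hamming w (candidate d) <= bottleneck_hamming w q)%E].
Proof.
move=> q_feas.
have [i [i_le q0 H_le]] : exists i, [/\ (i <= #|S|)%N,
    forall s, row_of w i < w s -> q s = 0 &
    forall s, w s <= row_of w i -> ((w s)%:E <= bottleneck_hamming w q)%E].
  case: (pickP (fun s => q s != 0)) => [s0 q_s0|q0]; last first.
    exists #|S|; split=> // s.
      by move=> _; apply/eqP; have /negbFE := q0 s.
    by rewrite row_of_default // leNgt w_gt0.
  have [s qs s_max] := @arg_maxP _ _ _ s0 (fun s => q s != 0) w q_s0.
  exists (enum_rank s); rewrite row_of_rank; split.
  - exact: ltnW.
  - move=> t; apply: contraTeq => qt; rewrite -leNgt; exact: s_max.
  - move=> t wt; apply: le_trans (_ : _ <= (w s)%:E)%E _.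
      by rewrite lee_fin.
    by rewrite /bottleneck_hamming (bigD1 s) //= le_max lexx.
exists i; split=> //; first exact: candidate_feasible q_feas q0.
move=> d d_le; apply/bigmax_leP; split=> [|s]; first exact: leNye.
rewrite ffunE; case: ifP => [|/negbT]; first by rewrite eqxx.
rewrite -leNgt => ws _; apply: H_le; exact: le_trans d_le.
Qed.

End Candidates.

(** * Reasoning about programs *)

Definition for_loop (i : nat) (e : nexp) (P : program) : program :=
  Seq (SetReg i (NConst 0))
      (While (BLtN (NReg i) e) (Seq P (SetReg i (NAdd (NReg i) (NConst 1))))).

Section Runs.
Variables (R : realType) (S : finType) (O : {ffun S -> R} -> {set S}).

Definition runs (P : program) (st : state R) (q : nat) (Q : state R -> Prop) :=
  exists q' st', [/\ exec O P st q' st', (q' <= q)%N & Q st'].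

(** The lists are those of the registers and rows that may have changed. *)
Definition frame (regs rows : seq nat) (st st' : state R) : Prop :=
  (forall i, i \notin regs -> reg st' i = reg st i) /\
  (forall a, a \notin rows -> cell st' a = cell st a).

Lemma frame_trans regs rows st1 st2 st3 :
  frame regs rows st1 st2 -> frame regs rows st2 st3 ->
  frame regs rows st1 st3.
Proof.
by move=> [r1 c1] [r2 c2]; split=> [i hi|a ha]; rewrite ?r2 ?c2 ?r1 ?c1.
Qed.

Lemma frame_sub regs rows regs' rows' st st' :
  all (mem regs') regs -> all (mem rows') rows ->
  frame regs rows st st' -> frame regs' rows' st st'.
Proof.
move=> /allP hr /allP hc [r1 c1]; split=> [i hi|a ha].
  by apply: r1; apply: contra hi => /hr.
by apply: c1; apply: contra ha => /hc.
Qed.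

Lemma frame_set_reg regs rows st i v :
  i \in regs -> frame regs rows st (set_reg st i v).
Proof.
by move=> hi; split=> // j hj /=; case: eqP => // ji; rewrite ji hi in hj.
Qed.

Lemma frame_set_row regs rows st a r :
  a \in rows -> frame regs rows st (set_row st a r).
Proof.
by move=> ha; split=> // b hb /=; case: eqP => // ba; rewrite ba ha in hb.
Qed.

Lemma runs_weaken P st q q' (Q Q' : state R -> Prop) :
  (q <= q')%N -> (forall st', Q st' -> Q' st') ->
  runs P st q Q -> runs P st q' Q'.
Proof.
move=> qq' QQ' [q1 [st1 [E q1q Q1]]]; exists q1, st1.
by split=> //; [exact: leq_trans qq' | exact: QQ'].
Qed.

Lemma runs_skip st (Q : state R -> Prop) : Q st -> runs Skip st 0 Q.
Proof. by move=> Qst; exists 0%N, st; split=> //; apply: exec_skip. Qed.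

Lemma runs_set_reg i e st (Q : state R -> Prop) :
  Q (set_reg st i (neval st e)) -> runs (SetReg i e) st 0 Q.
Proof. by move=> Qst; exists 0%N; eexists; split; [exact: exec_set_reg| |]. Qed.

Lemma runs_set_cell e1 e2 e st (Q : state R -> Prop) :
  Q (set_cell st (neval st e1) (neval st e2) (reval st e)) ->
  runs (SetCell e1 e2 e) st 0 Q.
Proof.
by move=> Qst; exists 0%N; eexists; split; [exact: exec_set_cell| |].
Qed.

Lemma runs_ask e st (Q : state R -> Prop) :
  Q (set_row st (neval st e)
       (row_of (indicator R (mem (O (vec_of S (cell st (neval st e)))))))) ->
  runs (Ask e) st 1 Q.
Proof. by move=> Qst; exists 1%N; eexists; split; [exact: exec_ask| |]. Qed.

Lemma runs_if b P1 P2 st q Q :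
  (beval st b -> runs P1 st q Q) -> (~~ beval st b -> runs P2 st q Q) ->
  runs (If b P1 P2) st q Q.
Proof.
move=> h1 h2.
have [q' [st' [E ? ?]]] : runs (if beval st b then P1 else P2) st q Q.
  by case: ifP => [/h1|/negbT/h2].
by exists q', st'; split=> //; apply: exec_if.
Qed.

Lemma runs_seq P1 P2 st q1 q2 (M Q : state R -> Prop) :
  runs P1 st q1 M -> (forall st', M st' -> runs P2 st' q2 Q) ->
  runs (Seq P1 P2) st (q1 + q2) Q.
Proof.
move=> [q [st1 [E1 qq M1]]] /(_ _ M1) [q' [st2 [E2 qq' Q2]]].
exists (q + q')%N, st2; split=> //; last exact: leq_add.
exact: exec_seq E1 E2.
Qed.

(** The loop counter enumerates the indices of the entries of [xs], and the
invariant speaks of the prefix already visited.  The frame is threaded through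
the loop by the rule itself, so that invariants need only mention what the body
computes. *)
Lemma runs_for (T : eqType) (idx : T -> nat) (xs : seq T) i e P q
    (regs rows : seq nat) (I : seq T -> state R -> Prop) st :
  map idx xs = iota 0 (size xs) -> i \notin regs ->
  (forall st', frame (i :: regs) rows st st' -> neval st' e = size xs) ->
  (forall ys st' v, I ys st' -> I ys (set_reg st' i v)) ->
  I [::] st ->
  (forall ys x st', x \in xs -> x \notin ys -> frame (i :: regs) rows st st' ->
     reg st' i = idx x -> I ys st' ->
     runs P st' q
       (fun st'' => frame regs rows st' st'' /\ I (rcons ys x) st'')) ->
  runs (for_loop i e P) st (size xs * q)
    (fun st' => frame (i :: regs) rows st st' /\ I xs st').
Proof.
move=> idx_xs i_regs e_size I_set I0 I_step; rewrite -[(_ * _)%N]add0n.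
apply: (runs_seq (M := fun st' => [/\ reg st' i = 0%N,
    frame (i :: regs) rows st st' & I [::] st'])).
  apply: runs_set_reg; split=> /=; first by rewrite eqxx.
    by apply: frame_set_reg; rewrite inE eqxx.
  exact: I_set.
suff loop zs : forall ys st', ys ++ zs = xs ->
    [/\ reg st' i = size ys, frame (i :: regs) rows st st' & I ys st'] ->
    runs (While (BLtN (NReg i) e) (Seq P (SetReg i (NAdd (NReg i) (NConst 1)))))
      st' (size zs * q)
      (fun st' => frame (i :: regs) rows st st' /\ I xs st').
  by move=> st'; apply: (loop xs [::]).
elim: zs => [|x zs IH] ys st' xsE [i_size fr I_ys].
  exists 0%N, st'; split=> //; last by rewrite -xsE cats0.
  by apply: exec_while_false; rewrite /= e_size // i_size -xsE cats0 ltnn.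
have i_x : reg st' i = idx x.
  rewrite i_size; have := congr1 (nth 0%N ^~ (size ys)) idx_xs.
  rewrite -xsE /= nth_iota ?size_cat /= ?addnS ?ltnS ?leq_addr // add0n => <-.
  rewrite (nth_map x) ?size_cat /= ?addnS ?ltnS ?leq_addr //.
  by rewrite nth_cat ltnn subnn.
have x_ys : x \notin ys.
  have : uniq xs by apply: (@map_uniq _ _ idx); rewrite idx_xs iota_uniq.
  by rewrite -xsE cat_uniq /= negb_or => /and3P[_ /andP[]].
have x_xs : x \in xs by rewrite -xsE mem_cat inE eqxx orbT.
have [q1 [st1 [E1 q1q [fr1 I1]]]] := I_step _ _ _ x_xs x_ys fr i_x I_ys.
have [||q2 [st2 [E2 q2q Q2]]] :=
    IH (rcons ys x) (set_reg st1 i (reg st1 i + 1)%N).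
- by rewrite cat_rcons.
- split; last exact: I_set.
    by rewrite /= eqxx fr1.1 // i_size size_rcons addn1.
  apply: frame_trans fr _; apply: frame_trans (_ : frame _ _ _ st1) _.
    apply: frame_sub fr1; apply/allP => j /=; rewrite ?inE => ->;
      by rewrite ?orbT.
  by apply: frame_set_reg; rewrite inE eqxx.
exists (q1 + 0 + q2)%N, st2; split=> //.
  apply: exec_while_true E2.
    by rewrite /= e_size // i_size -xsE size_cat /= addnS ltnS leq_addr.
  by apply: exec_seq E1 _; exact: exec_set_reg.
by rewrite addn0 mulSn leq_add.
Qed.

End Runs.

(** * The program *)

(** Allocation of registers and rows.  The finiteness flags of the bounds are
consumed by the computation of the extreme deviation values, after which their
two rows are reused.  The first row beyond the input, [scratch], holds the
queries and the answers; its cell in column [#|S|], outside the part read by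
the oracle, serves as accumulator. *)
Local Notation size_reg := 0%N (only parsing).
Local Notation count_reg := 1%N (only parsing).
Local Notation thr_reg := 2%N (only parsing).
Local Notation cost_reg := 3%N (only parsing).
Local Notation elt_reg := 4%N (only parsing).
Local Notation best_reg := 5%N (only parsing).
Local Notation bad_reg := 6%N (only parsing).

Local Notation Fstar_row := 0%N (only parsing).
Local Notation w_row := 1%N (only parsing).
Local Notation lfin_row := 2%N (only parsing).
Local Notation l_row := 3%N (only parsing).
Local Notation ufin_row := 4%N (only parsing).
Local Notation u_row := 5%N (only parsing).
Local Notation extreme_row := 2%N (only parsing).
Local Notation candidate_row := 4%N (only parsing).

Definition elt_cell (a : nat) : rexp := RCell (NConst a) (NReg elt_reg).
Definition cost_cell : rexp :=
  RCell (NAdd (NConst 6) (NReg cost_reg)) (NReg elt_reg).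
Definition scratch : nexp := NAdd (NConst 6) (NReg count_reg).
Definition acc : rexp := RCell scratch (NReg size_reg).
Definition add_to_acc (e : rexp) : program :=
  SetCell scratch (NReg size_reg) (RAdd acc e).
Definition set_elt (a : nat) (e : rexp) : program :=
  SetCell (NConst a) (NReg elt_reg) e.
Definition for_elt : program -> program := for_loop elt_reg (NReg size_reg).
Definition for_cost : program -> program := for_loop cost_reg (NReg count_reg).
Definition sqr_exp (e : rexp) : rexp := RMul e e.

Definition compute_bigM : program :=
  for_cost (for_elt (add_to_acc
    (RAdd (sqr_exp cost_cell)
       (RAdd (sqr_exp (elt_cell l_row))
          (RAdd (sqr_exp (elt_cell u_row)) (RConst 1)))))).

(** The flags of membership in [Fstar] and of finiteness select the right case
arithmetically; this relies on [fine] being [0] at infinities. *)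
Definition compute_extreme : program :=
  let F := elt_cell Fstar_row in
  let co e := RSub (RConst 1) e in
  for_elt (set_elt extreme_row
    (RAdd (RMul F (RAdd (elt_cell u_row)
                        (RMul (co (elt_cell ufin_row)) acc)))
          (RMul (co F) (RSub (elt_cell l_row)
                             (RMul (co (elt_cell lfin_row)) acc))))).

(** Besides writing the candidate, it raises [bad_reg] if a deviation is forced
to be zero where the bounds exclude zero. *)
Definition write_candidate (r dst : nat) : program :=
  for_elt (If (BLtR (RCell (NConst w_row) (NReg r)) (elt_cell w_row))
    (Seq (set_elt dst (RConst 0))
         (If (BAnd (BNot (BLtR (RConst 0) (elt_cell l_row)))
                   (BNot (BLtR (elt_cell u_row) (RConst 0))))
             Skip (SetReg bad_reg (NConst 1))))
    (set_elt dst (elt_cell extreme_row))).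

(** The accumulator needs no reset before the second loop: answering a query
overwrites the whole scratch row, and clears the columns from [#|S|] on. *)
Definition test_cost : program :=
  let query := RSub cost_cell (elt_cell candidate_row) in
  Seq (for_elt (SetCell scratch (NReg elt_reg) query))
  (Seq (Ask scratch)
  (Seq (for_elt (add_to_acc
          (RMul (RSub (elt_cell Fstar_row) (RCell scratch (NReg elt_reg)))
                query)))
       (If (BLtR (RConst 0) acc) (SetReg bad_reg (NConst 1)) Skip))).

Definition test_candidate : program :=
  Seq (SetReg bad_reg (NConst 0))
  (Seq (write_candidate thr_reg candidate_row) (for_cost test_cost)).

Definition thr_count : nexp := NAdd (NReg size_reg) (NConst 1).

(** The best index so far is [#|S| + 1] as long as no candidate has passed. *)
Definition search : program :=
  for_loop thr_reg thr_count
    (Seq test_candidate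
      (If (BAnd (BLtN (NReg bad_reg) (NConst 1))
             (BNot (BAnd (BLtN (NReg best_reg) thr_count)
                         (BNot (BLtR (RCell (NConst w_row) (NReg thr_reg))
                                     (RCell (NConst w_row) (NReg best_reg)))))))
          (SetReg best_reg (NReg thr_reg)) Skip)).

Definition solve_nonempty : program :=
  Seq compute_bigM
  (Seq compute_extreme
  (Seq (SetReg best_reg thr_count)
  (Seq search
       (If (BLtN (NReg best_reg) thr_count)
           (Seq (write_candidate best_reg 0) (SetReg 0 (NConst 1)))
           (SetReg 0 (NConst 0)))))).

Definition bottleneck_algorithm : program :=
  If (BLtN (NConst 0) (NReg size_reg)) solve_nonempty (SetReg 0 (NConst 1)).

(** * Correctness of the program *)

Section Correctness.
Variables (R : realType) (S : finType).
Variables (F : {set {set S}}) (Fstar : {set S}) (k : nat).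
Variables (c : 'I_k -> {ffun S -> R}) (w : {ffun S -> R}) (l u : S -> \bar R).
Variable O : {ffun S -> R} -> {set S}.
Hypothesis Fstar_in : Fstar \in F.
Hypothesis k_gt0 : (0 < k)%N.
Hypothesis w_gt0 : forall s, 0 < w s.
Hypothesis l_lty : forall s, l s != +oo%E.
Hypothesis u_gtNy : forall s, u s != -oo%E.
Hypothesis l_le_u : forall s, (l s <= u s)%E.
Hypothesis oracle : min_cost_oracle F O.

Local Notation n := #|S|.
Local Notation rank := (fun s : S => enum_rank s : nat).
Local Notation bigM := (bigM c l u).
Local Notation extreme := (extreme Fstar c l u).
Local Notation candidate := (candidate Fstar c w l u).
Local Notation zero_in_bounds := (zero_in_bounds l u).
Local Notation feasible := (feasible_deviation F Fstar c l u).
Local Notation thr := (row_of w).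
Local Notation scr := (6 + k)%N.

(** The part of the input that stays in place until the output is written. *)
Record holds_data (st : state R) : Prop := HoldsData {
  data_size : reg st size_reg = n;
  data_count : reg st count_reg = k;
  data_Fstar : cell st Fstar_row = row_of (indicator R (mem Fstar));
  data_w : cell st w_row = thr;
  data_l : cell st l_row = row_of (fun s => fine (l s));
  data_u : cell st u_row = row_of (fun s => fine (u s));
  data_c : forall j : 'I_k, cell st (6 + j) = row_of (c j)
}.

Definition holds_row (a : nat) (f : S -> R) (st : state R) : Prop :=
  forall s, cell st a (enum_rank s) = f s.

Lemma holds_data_frame regs rows st st' :
  all (leq 2) regs -> all (mem [:: extreme_row; candidate_row; scr]) rows ->
  frame regs rows st st' -> holds_data st -> holds_data st'.
Proof.
move=> /allP hr /allP hc [r1 c1] [d1 d2 d3 d4 d5 d6 d7].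
have rN i : (i < 2)%N -> reg st' i = reg st i.
  by move=> hi; apply: r1; apply/negP => /hr; rewrite leqNgt hi.
have cN a : a \notin [:: extreme_row; candidate_row; scr] ->
    cell st' a = cell st a.
  by move=> ha; apply: c1; apply: contra ha => /hc.
split; rewrite ?rN ?cN // => j; rewrite cN //.
by rewrite !inE eqn_add2l (ltn_eqF (ltn_ord j)).
Qed.

Lemma map_rank : map rank (enum S) = iota 0 n.
Proof.
apply: (@eq_from_nth _ 0%N) => [|i]; first by rewrite size_map size_iota -cardE.
rewrite size_map -cardE => i_lt; pose s := enum_val (Ordinal i_lt).
rewrite (nth_map s) -?cardE // nth_iota //.
by rewrite -(enum_val_nth s (Ordinal i_lt)) enum_valK.
Qed.

Lemma size_enum : size (enum S) = n.
Proof. by rewrite -cardE. Qed.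

Lemma runs_for_elt P (regs rows : seq nat) (I : seq S -> state R -> Prop)
    (Q : state R -> Prop) st :
  reg st size_reg = n -> all (fun i => i \notin [:: size_reg; elt_reg]) regs ->
  (forall ys st' v, I ys st' -> I ys (set_reg st' elt_reg v)) ->
  I [::] st ->
  (forall ys s st', s \notin ys -> frame (elt_reg :: regs) rows st st' ->
     reg st' elt_reg = enum_rank s -> I ys st' ->
     runs O P st' 0
      (fun st'' => frame regs rows st' st'' /\ I (rcons ys s) st'')) ->
  (forall st', frame (elt_reg :: regs) rows st st' -> I (enum S) st' ->
     Q st') ->
  runs O (for_elt P) st 0 Q.
Proof.
move=> st_n /allP regsP I_set I0 I_step I_Q.
apply: (@runs_weaken _ _ _ _ _ (size (enum S) * 0) _
  (fun st' => frame (elt_reg :: regs) rows st st' /\ I (enum S) st')).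
- by rewrite muln0.
- by move=> st' [fr]; apply: I_Q.
apply: (runs_for (idx := rank)) => //.
- by rewrite map_rank size_enum.
- by apply/negP => /regsP.
- move=> st' fr /=; rewrite fr.1 ?st_n ?size_enum // inE negb_or /=.
  by apply/negP => /regsP.
- by move=> ys s st' _; apply: I_step.
Qed.

Lemma runs_for_cost P q (regs rows : seq nat)
    (I : seq 'I_k -> state R -> Prop) (Q : state R -> Prop) st :
  reg st count_reg = k ->
  all (fun i => i \notin [:: count_reg; cost_reg]) regs ->
  (forall ys st' v, I ys st' -> I ys (set_reg st' cost_reg v)) ->
  I [::] st ->
  (forall ys (j : 'I_k) st', j \notin ys ->
     frame (cost_reg :: regs) rows st st' -> reg st' cost_reg = j -> I ys st' ->
     runs O P st' q
      (fun st'' => frame regs rows st' st'' /\ I (rcons ys j) st'')) ->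
  (forall st', frame (cost_reg :: regs) rows st st' -> I (enum 'I_k) st' ->
     Q st') ->
  runs O (for_cost P) st (k * q) Q.
Proof.
move=> st_k /allP regsP I_set I0 I_step I_Q.
apply: (@runs_weaken _ _ _ _ _ (size (enum 'I_k) * q) _
  (fun st' => frame (cost_reg :: regs) rows st st' /\ I (enum 'I_k) st')).
- by rewrite size_enum_ord.
- by move=> st' [fr]; apply: I_Q.
apply: (runs_for (idx := @nat_of_ord k)) => //.
- by rewrite val_enum_ord size_enum_ord.
- by apply/negP => /regsP.
- move=> st' fr /=; rewrite fr.1 ?st_k ?size_enum_ord // inE negb_or /=.
  by apply/negP => /regsP.
- by move=> ys s st' _; apply: I_step.
Qed.

Lemma compute_bigM_runs st : holds_data st -> cell st scr n = 0 ->
  runs O compute_bigM st 0 (fun st' =>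
    frame [:: cost_reg; elt_reg] [:: scr] st st' /\ cell st' scr n = bigM).
Proof.
move=> data acc0.
pose T j := \sum_s size_term c l u j s.
rewrite -[X in runs _ _ _ X](muln0 k).
apply: (runs_for_cost (regs := [:: elt_reg]) (rows := [:: scr])
  (I := fun js st => cell st scr n = \sum_(j <- js) T j)) => //.
- exact: data_count.
- by rewrite big_nil.
2: by move=> st' fr ->; rewrite big_enum.
move=> js j st1 _ fr1 jE IE.
have data1 : holds_data st1.
  by apply: holds_data_frame fr1 data; rewrite //= !inE eqxx.
apply: (runs_for_elt (regs := [::]) (rows := [:: scr])
  (I := fun ys st => cell st scr n =
          \sum_(j <- js) T j + \sum_(s <- ys) size_term c l u j s)) => //.
- exact: data_size.
- by rewrite big_nil addr0.
2: by move=> st' fr ->; rewrite big_enum -cats1 big_cat big_seq1.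
move=> ys s st2 _ fr2 sE IE2; apply: runs_set_cell.
have data2 : holds_data st2.
  by apply: holds_data_frame fr2 data1; rewrite //= !inE eqxx.
have j2 : reg st2 cost_reg = j by rewrite fr2.1.
rewrite /= (data_size data2) (data_count data2) sE j2 (data_c data2).
rewrite (data_l data2) (data_u data2) !row_of_rank; split.
  by apply: frame_set_row; rewrite inE eqxx.
by rewrite /= eqxx /= eqxx IE2 -cats1 big_cat big_seq1 -addrA.
Qed.

(** The row of results overwrites the flags of the lower bounds in place, so
the invariant also has to retain the flags not yet visited. *)
Lemma compute_extreme_runs st : holds_data st ->
  cell st lfin_row = row_of (indicator R (fun s => l s \is a fin_num)) ->
  cell st ufin_row = row_of (indicator R (fun s => u s \is a fin_num)) ->
  cell st scr n = bigM ->
  runs O compute_extreme st 0 (fun st' =>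
    frame [:: elt_reg] [:: extreme_row] st st' /\
    holds_row extreme_row extreme st').
Proof.
move=> data lfin ufin accM.
apply: (runs_for_elt (regs := [::]) (rows := [:: extreme_row])
  (I := fun ys st => forall s, cell st extreme_row (enum_rank s) =
      if s \in ys then extreme s else (l s \is a fin_num)%:R)) => //.
- exact: data_size.
- by move=> s; rewrite lfin row_of_rank.
2: by move=> st' fr rowE; split=> // s; rewrite rowE mem_enum.
move=> ys s st1 s_ys fr1 sE rowE; apply: runs_set_cell; split.
  exact: frame_set_row.
have data1 : holds_data st1 by apply: holds_data_frame fr1 data.
move=> t; rewrite /= sE mem_rcons inE.
have -> : (enum_rank t == enum_rank s :> nat) = (t == s).
  by rewrite (inj_eq val_inj) (inj_eq enum_rank_inj).
case: eqP => [->|_]; last exact: rowE.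
rewrite (data_size data1) (data_count data1) (data_l data1) (data_u data1).
rewrite (data_Fstar data1) rowE (negPf s_ys) !(fr1.2) // ufin accM !row_of_rank.
rewrite /indicator /extreme /=.
case: (s \in Fstar) => /=; move: (u_gtNy s) (l_lty s);
  case: (u s) => [b||] //=; case: (l s) => [a||] //= _ _; lra.
Qed.

Definition bounds_ok (d : R) : Prop := forall s, d < w s -> zero_in_bounds s.

Lemma write_candidate_runs (r dst : nat) st :
  holds_data st -> holds_row extreme_row extreme st ->
  r \notin [:: elt_reg; bad_reg] ->
  dst \in [:: 0%N; candidate_row] ->
  runs O (write_candidate r dst) st 0 (fun st' =>
    [/\ frame [:: elt_reg; bad_reg] [:: dst] st st',
        holds_row dst (candidate (thr (reg st r))) st' &
        reg st' bad_reg = 0%N <->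
          reg st bad_reg = 0%N /\ bounds_ok (thr (reg st r))]).
Proof.
move=> data ext r_safe dst_safe; set d := thr _.
pose I (ys : seq S) st' := [/\ forall s, s \in ys ->
      cell st' dst (enum_rank s) = candidate d s
  & reg st' bad_reg = 0%N <->
    reg st bad_reg = 0%N /\
    forall s, s \in ys -> d < w s -> zero_in_bounds s].
apply: (runs_for_elt (regs := [:: bad_reg]) (rows := [:: dst]) (I := I)) => //.
- exact: data_size.
- by split=> //; split=> [|[]].
2: {
  move=> st' fr [rowE badE]; split=> //.
    by move=> s; apply: rowE; rewrite mem_enum.
  rewrite badE; split=> -[? zs]; split=> // s *;
    by apply: zs; rewrite ?mem_enum.
}
move=> ys s st1 s_ys fr1 sE [rowE badE].
have dst_notin a : a \notin [:: 0%N; candidate_row] -> a \notin [:: dst].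
  by move=> ha; rewrite inE; apply: contra ha => /eqP->.
have [cell1 cell2 cell3 cell5] : [/\ cell st1 w_row = thr,
    holds_row extreme_row extreme st1,
    cell st1 l_row = row_of (fun s => fine (l s))
  & cell st1 u_row = row_of (fun s => fine (u s))].
  by split; [|move=> t| |]; rewrite fr1.2 ?dst_notin //; apply data.
have r1 : reg st1 r = reg st r by rewrite fr1.1.
have rank_eq t : (enum_rank t == enum_rank s :> nat) = (t == s).
  by rewrite (inj_eq val_inj) (inj_eq enum_rank_inj).
apply: runs_if; rewrite /= cell1 sE r1 row_of_rank -/d => dw.
  rewrite -[0%N]add0n; apply: (runs_seq (M := fun st2 =>
     [/\ frame [::] [:: dst] st1 st2 &
     (forall t, t \in rcons ys s ->
        cell st2 dst (enum_rank t) = candidate d t)])).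
    apply: runs_set_cell; split.
      by apply: frame_set_row; rewrite inE eqxx.
    move=> t; rewrite /= eqxx sE /= rank_eq mem_rcons inE ffunE.
    by case: eqP => [->|_ /rowE] //=; rewrite ?dw // ffunE.
  move=> st2 [fr2 row2].
  have fr21 : frame [:: bad_reg] [:: dst] st1 st2.
    by apply: frame_sub fr2; rewrite //= inE eqxx.
  have zE : beval st2 (BAnd (BNot (BLtR (RConst 0) (elt_cell l_row)))
       (BNot (BLtR (elt_cell u_row) (RConst 0)))) = zero_in_bounds s.
    by rewrite /= fr2.1 // sE !fr2.2 ?dst_notin // cell3 cell5 !row_of_rank.
  apply: runs_if; rewrite zE => z.
    apply: runs_skip; split=> //; split=> //; rewrite fr2.1 // badE.
    split=> -[bad0 zs]; split=> // t; last first.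
      by move=> ty; apply: zs; rewrite mem_rcons inE ty orbT.
    by rewrite mem_rcons inE => /predU1P[->|/zs].
  apply: runs_set_reg; split.
    by apply: frame_trans fr21 _; apply: frame_set_reg.
  split=> //; split=> //= -[_ /(_ s)].
  rewrite mem_rcons inE eqxx /= => /(_ isT dw).
  by rewrite (negPf z).
apply: runs_set_cell; split; first by apply: frame_set_row; rewrite inE eqxx.
split=> [t|].
  rewrite /= eqxx sE /= rank_eq mem_rcons inE ffunE.
  by case: eqP => [->|_ /rowE] //=; rewrite ?(negPf dw) ?cell2 // ffunE.
rewrite /= badE; split=> -[bad0 zs]; split=> // t; last first.
  by move=> ty; apply: zs; rewrite mem_rcons inE ty orbT.
by rewrite mem_rcons inE => /predU1P[->|/zs //]; rewrite (negPf dw).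
Qed.

Definition cost_ok (d : R) (j : 'I_k) : Prop :=
  cost (c j - candidate d) Fstar
    <= cost (c j - candidate d) (O (c j - candidate d)).

(** The accumulated sum is the cost of [Fstar] minus that of the oracle's
answer, by [cost_diff]. *)
Lemma test_cost_runs d (j : 'I_k) st : holds_data st ->
  holds_row candidate_row (candidate d) st -> reg st cost_reg = j ->
  runs O test_cost st 1 (fun st' =>
    frame [:: elt_reg; bad_reg] [:: scr] st st' /\
    (reg st' bad_reg = 0%N <-> reg st bad_reg = 0%N /\ cost_ok d j)).
Proof.
move=> data cand jE.
pose v := c j - candidate d.
have vE s : v s = c j s - candidate d s by rewrite !ffunE.
rewrite -[1%N]add0n; apply: (runs_seq (M := fun st1 =>
   frame [:: elt_reg] [:: scr] st st1 /\ holds_row scr v st1)).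
  apply: (runs_for_elt (regs := [::]) (rows := [:: scr])
    (I := fun ys st' => forall s, s \in ys ->
            cell st' scr (enum_rank s) = v s)) => //.
  - exact: data_size.
  2: by move=> st' fr rowE; split=> // s; apply: rowE; rewrite mem_enum.
  move=> ys s st1 _ fr1 sE rowE; apply: runs_set_cell.
  have data1 : holds_data st1.
    by apply: holds_data_frame fr1 data; rewrite //= !inE eqxx.
  split; rewrite /= (data_count data1).
    by apply: frame_set_row; rewrite inE eqxx.
  move=> t; rewrite /= eqxx sE /= (inj_eq val_inj) (inj_eq enum_rank_inj).
  rewrite mem_rcons inE fr1.1 // jE (data_c data1) (fr1.2 candidate_row) //.
  by case: eqP => [->|_ /rowE] //=; rewrite row_of_rank cand vE.
move=> st1 [fr1 row1].
have data1 : holds_data st1.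
  by apply: holds_data_frame fr1 data; rewrite //= !inE eqxx.
have vecE : vec_of S (cell st1 scr) = v.
  by apply/ffunP => s; rewrite ffunE row1.
rewrite -[1%N]addn0; apply: (runs_seq (M := fun st2 =>
  frame [::] [:: scr] st1 st2 /\
  cell st2 scr = row_of (indicator R (mem (O v))))).
  apply: runs_ask; rewrite /= (data_count data1) vecE; split.
    by apply: frame_set_row; rewrite inE eqxx.
  by rewrite /= eqxx.
move=> st2 [fr2 row2].
have data2 : holds_data st2.
  by apply: holds_data_frame fr2 data1; rewrite //= !inE eqxx.
have frame2 : frame [:: elt_reg] [:: scr] st st2.
  by apply: frame_trans fr1 _; apply: frame_sub fr2; rewrite //= inE eqxx.
pose term s := ((s \in Fstar)%:R - (s \in O v)%:R) * v s.
rewrite -[0%N]addn0; apply: (runs_seq (M := fun st3 =>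
   frame [:: elt_reg] [:: scr] st2 st3 /\
   cell st3 scr n = cost v Fstar - cost v (O v))).
  apply: (runs_for_elt (regs := [::]) (rows := [:: scr])
    (I := fun ys st3 => [/\ cell st3 scr n = \sum_(s <- ys) term s &
       holds_row scr (indicator R (mem (O v))) st3])) => //.
  - exact: data_size.
  - split; last by move=> s; rewrite row2 row_of_rank.
    by rewrite row2 row_of_default ?big_nil.
  2: by move=> st3 fr [-> _]; rewrite cost_diff big_enum.
  move=> ys s st3 _ fr3 sE [accE rowE].
  have data3 : holds_data st3.
    by apply: holds_data_frame fr3 data2; rewrite //= !inE eqxx.
  have j3 : reg st3 cost_reg = j by rewrite fr3.1 // fr2.1 // fr1.1.
  have c4 : cell st3 candidate_row = cell st candidate_row.
    by rewrite fr3.2 // frame2.2.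
  apply: runs_set_cell; rewrite /= (data_count data3) (data_size data3) sE j3.
  rewrite (data_Fstar data3) (data_c data3) c4 cand rowE !row_of_rank accE.
  split.
    by apply: frame_set_row; rewrite inE eqxx.
  split=> [|t]; rewrite /= !eqxx /= ?eqxx.
    by rewrite -cats1 big_cat big_seq1 /= /term vE.
  by rewrite (ltn_eqF (ltn_ord _)); apply: rowE.
move=> st3 [fr3 accE].
have frame3 : frame [:: elt_reg; bad_reg] [:: scr] st st3.
  by apply: frame_sub (frame_trans frame2 fr3); rewrite //= inE eqxx.
have bE : beval st3 (BLtR (RConst 0) acc) = ~~ (cost v Fstar <= cost v (O v)).
  rewrite /= fr3.1 // fr3.1 // (data_count data2) (data_size data2) accE.
  by rewrite subr_gt0 -ltNge.
have r6 : reg st3 bad_reg = reg st bad_reg by rewrite fr3.1 // frame2.1.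
apply: runs_if; rewrite bE ?negbK => ok.
  apply: runs_set_reg; split.
    by apply: frame_trans frame3 _; apply: frame_set_reg.
  by split=> //= -[_]; rewrite /cost_ok -/v (negPf ok).
by apply: runs_skip; split=> //; rewrite r6; split=> [|[]].
Qed.

Lemma test_candidate_runs st :
  holds_data st -> holds_row extreme_row extreme st ->
  runs O test_candidate st k (fun st' =>
    frame [:: cost_reg; elt_reg; bad_reg] [:: candidate_row; scr] st st' /\
    (reg st' bad_reg = 0%N <-> feasible (candidate (thr (reg st thr_reg))))).
Proof.
move=> data ext; set d := thr _.
apply: (runs_seq (q1 := 0) (q2 := k)
  (M := fun st' => st' = set_reg st bad_reg 0)).
  exact: runs_set_reg.
move=> _ ->.
apply: (runs_seq (q1 := 0) (q2 := k)
  (write_candidate_runs (st := set_reg st bad_reg 0) _ _ _ _)) => //.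
  have fr0 : frame [:: bad_reg] [::] st (set_reg st bad_reg 0).
    exact: frame_set_reg.
  exact: holds_data_frame fr0 data.
move=> st1 [fr1 row1]; rewrite /= -/d => bad1.
have frame1 : frame [:: elt_reg; bad_reg] [:: candidate_row; scr] st st1.
  apply: frame_trans (_ : frame _ _ st (set_reg st bad_reg 0)) _.
    exact: frame_set_reg.
  exact: frame_sub fr1.
have data1 : holds_data st1.
  by apply: holds_data_frame frame1 data; rewrite //= !inE eqxx ?orbT.
rewrite -[X in runs _ _ _ X]muln1.
apply: (runs_for_cost (regs := [:: elt_reg; bad_reg]) (rows := [:: scr])
  (I := fun js st2 => reg st2 bad_reg = 0%N <->
     bounds_ok d /\ forall j, j \in js -> cost_ok d j)) => //.
- exact: data_count.
- by rewrite bad1; split=> -[].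
2: {
  move=> st2 fr2 badE; split.
    apply: frame_trans (_ : frame _ _ _ st1) _.
      by apply: frame_sub frame1; rewrite //= !inE !eqxx ?orbT.
    by apply: frame_sub fr2; rewrite //= !inE !eqxx ?orbT.
  have [to_ok of_ok] : feasible (candidate d) <->
      bounds_ok d /\ forall j, cost_ok d j by exact: feasible_candidateP.
  split=> [/badE[z mins]|/to_ok[z mins]]; [apply: of_ok|apply/badE];
    by split=> // j *; apply: mins; rewrite ?mem_enum.
}
move=> js j st2 _ fr2 jE badE.
have data2 : holds_data st2.
  by apply: holds_data_frame fr2 data1; rewrite //= !inE eqxx ?orbT.
apply: runs_weaken (test_cost_runs data2 (d := d) _ jE) => //; last first.
  by move=> s; rewrite fr2.2 // row1.
move=> st3 [fr3 bad3]; split=> //; rewrite bad3 badE.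
split=> [[[z mins] okj]|[z mins]]; split=> //.
- by move=> i; rewrite mem_rcons inE => /predU1P[->|/mins].
- by split=> // i ij; apply: mins; rewrite mem_rcons inE ij orbT.
- by apply: mins; rewrite mem_rcons inE eqxx.
Qed.

(** The value [n.+1] of [b] stands for the absence of a feasible candidate. *)
Definition best_among (ys : seq nat) (b : nat) : Prop :=
  ((b <= n)%N -> feasible (candidate (thr b))) /\
  forall i, i \in ys -> feasible (candidate (thr i)) ->
    (b <= n)%N /\ thr b <= thr i.

Lemma search_runs st : holds_data st -> holds_row extreme_row extreme st ->
  reg st best_reg = n.+1 ->
  runs O search st (n.+1 * k) (fun st' =>
    frame [:: thr_reg; cost_reg; elt_reg; best_reg; bad_reg]
          [:: candidate_row; scr] st st' /\
    best_among (iota 0 n.+1) (reg st' best_reg)).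
Proof.
move=> data ext best0; rewrite -[n.+1 in X in runs _ _ _ X](size_iota 0).
apply: (runs_for (idx := id)
  (regs := [:: cost_reg; elt_reg; best_reg; bad_reg])
  (rows := [:: candidate_row; scr])
  (I := fun ys st' => best_among ys (reg st' best_reg))) => //.
- by rewrite map_id size_iota.
- by move=> st' fr; rewrite /= size_iota fr.1 // (data_size data) addn1.
- by rewrite best0; split=> //; rewrite ltnn.
move=> ys i st1; rewrite mem_iota ltnS => /andP[_ i_n] _ fr1 iE [b_feas b_min].
have data1 : holds_data st1.
  by apply: holds_data_frame fr1 data; rewrite //= !inE eqxx ?orbT.
rewrite -[X in runs _ _ _ X]addn0; apply: runs_seq.
  by apply: test_candidate_runs => // s; rewrite fr1.2.
move=> st2 [fr2]; rewrite iE => feasE.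
have data2 : holds_data st2.
  by apply: holds_data_frame fr2 data1; rewrite //= !inE eqxx ?orbT.
have frame2 : frame [:: cost_reg; elt_reg; best_reg; bad_reg]
    [:: candidate_row; scr] st1 st2.
  by apply: frame_sub fr2; rewrite //= !inE !eqxx ?orbT.
set b := reg st1 best_reg in b_feas b_min.
have bE : beval st2 (BAnd (BLtN (NReg bad_reg) (NConst 1))
   (BNot (BAnd (BLtN (NReg best_reg) thr_count)
      (BNot (BLtR (RCell (NConst w_row) (NReg thr_reg))
                  (RCell (NConst w_row) (NReg best_reg))))))) =
  (reg st2 bad_reg == 0%N) && ~~ ((b <= n)%N && (thr b <= thr i)).
  rewrite /= (data_size data2) (data_w data2) addn1 !ltnS leqn0.
  by rewrite (fr2.1 thr_reg) // (fr2.1 best_reg) // iE -leNgt.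
apply: runs_if; rewrite bE.
  move=> /andP[/eqP/feasE i_feas worse]; apply: runs_set_reg; split.
    by apply: frame_trans frame2 _; apply: frame_set_reg.
  rewrite /= fr2.1 // iE; split=> // t; rewrite mem_rcons inE => /predU1P[->|].
    by [].
  move=> /b_min h /h [b_n bt]; split=> //; apply: le_trans bt.
  by move: worse; rewrite b_n -ltNge => /ltW.
move=> keep; apply: runs_skip; split=> //; rewrite fr2.1 //; split=> // t.
rewrite mem_rcons inE => /predU1P[->|]; last exact: b_min.
move=> /feasE bad0; move: keep; rewrite bad0 eqxx /= negbK => /andP[]; by split.
Qed.

Lemma holds_data_input : holds_data (input Fstar c w l u).
Proof. by split=> // j; rewrite /= valK. Qed.

Lemma solve_nonempty_runs : exists q st,
  [/\ exec O solve_nonempty (input Fstar c w l u) q st, (q <= n.+1 * k)%N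
    & correct_output F Fstar c w l u (output S st)].
Proof.
have data := holds_data_input; set st0 := input _ _ _ _ _ in data *.
(* Rows beyond the input are zero, hence so is the accumulator. *)
have scr_row : cell st0 scr = fun=> 0 by rewrite /= insubF // ltnn.
have : runs O solve_nonempty st0 (0 + (0 + (0 + (n.+1 * k + 0))))
    (fun st => correct_output F Fstar c w l u (output S st)).
  apply: runs_seq (compute_bigM_runs data _) _; first by rewrite scr_row.
  move=> st1 [fr1 accM].
  have data1 : holds_data st1.
    by apply: holds_data_frame fr1 data; rewrite //= !inE eqxx.
  apply: runs_seq (compute_extreme_runs data1 _ _ accM) _; rewrite ?fr1.2 //.
  move=> st2 [fr2 ext2].
  have data2 : holds_data st2 by apply: holds_data_frame fr2 data1.
  apply: (runs_seq (M := fun st => st = set_reg st2 best_reg n.+1)).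
    by apply: runs_set_reg; rewrite /= (data_size data2) addn1.
  move=> _ ->.
  have data3 : holds_data (set_reg st2 best_reg n.+1).
    have fr3 : frame [:: best_reg] [::] st2 (set_reg st2 best_reg n.+1).
      exact: frame_set_reg.
    exact: holds_data_frame fr3 data2.
  apply: runs_seq (search_runs data3 _ _) _ => // st4 [fr4 [b_feas b_min]].
  have data4 : holds_data st4.
    by apply: holds_data_frame fr4 data3; rewrite //= !inE eqxx ?orbT.
  set b := reg st4 best_reg in b_feas b_min.
  have bE : beval st4 (BLtN (NReg best_reg) thr_count) = (b <= n)%N.
    by rewrite /= (data_size data4) addn1 ltnS.
  have H_exists q : feasible q -> exists i, [/\ i \in iota 0 n.+1,
      feasible (candidate (thr i)) & forall d, d <= thr i ->
     (bottleneck_hamming w (candidate d) <= bottleneck_hamming w q)%E].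
    move=> q_feas.
    have [i [i_n ? ?]] := threshold_exists Fstar_in k_gt0 w_gt0 l_lty u_gtNy
      l_le_u q_feas.
    by exists i; rewrite mem_iota.
  apply: runs_if; rewrite bE => b_n.
    (* The output may overwrite the row of [Fstar]: membership in [Fstar] is
       already encoded in the row of extreme values. *)
    rewrite -[0%N]addn0; apply: runs_seq.
      by apply: write_candidate_runs => // s; rewrite fr4.2 // ext2.
    move=> st5 [_ row5 _]; apply: runs_set_reg.
    have -> : output S (set_reg st5 0 (neval st5 (NConst 1))) =
        Some (candidate (thr b)).
      by rewrite /output /=; congr Some; apply/ffunP => s; rewrite ffunE row5.
    split; first exact: b_feas.
    move=> q /H_exists[i [i_in i_feas H_le]]; apply: H_le.
    exact: (b_min i i_in i_feas).2.
  apply: runs_set_reg => /= -[q /H_exists[i [i_in i_feas _]]].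
  by rewrite (b_min i i_in i_feas).1 in b_n.
by move=> [q [st [E q_le ok]]]; exists q, st; split=> //; rewrite addn0 in q_le.
Qed.

Lemma empty_correct p : n = 0%N -> correct_output F Fstar c w l u (Some p).
Proof.
move=> n0; have noS : S -> False.
  by move=> s; have := max_card (pred1 s); rewrite card1 n0.
have sumE (a : {ffun S -> R}) X : cost a X = 0.
  by rewrite /cost big1 // => s; case: (noS s).
split; first split.
- by move=> j; split=> // Y _; rewrite !sumE.
- by move=> s; case: (noS s).
- by move=> q _; apply/bigmax_leP; split=> [|s]; [exact: leNye|case: (noS s)].
Qed.

End Correctness.

Theorem corollary5 (R : realType) :
  exists (alg : program) (C : nat),
  forall (S : finType) (F : {set {set S}}) (Fstar : {set S})
    (k : nat) (c : 'I_k -> {ffun S -> R}) (w : {ffun S -> R})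
    (l u : S -> \bar R) (O : {ffun S -> R} -> {set S}),
    Fstar \in F ->
    (0 < k)%N ->
    (forall s, 0 < w s) ->
    (forall s, l s != +oo%E) ->
    (forall s, u s != -oo%E) ->
    (forall s, (l s <= u s)%E) ->
    min_cost_oracle F O ->
    exists (q : nat) (st : state R),
      [/\ exec O alg (input Fstar c w l u) q st,
          (q <= C * (k * #|S|))%N
        & correct_output F Fstar c w l u (output S st)].
Proof.
exists bottleneck_algorithm, 2%N => S F Fstar k c w l u O.
move=> Fstar_in k_gt0 w_gt0 l_lty u_gtNy l_le_u oracle.
have [S0|S_gt0] := posnP #|S|.
  exists 0%N, (set_reg (input Fstar c w l u) 0 1); split=> //.
    by apply: exec_if; rewrite /= S0; exact: exec_set_reg.
  exact: empty_correct.
have [q [st [E q_le ok]]] := solve_nonempty_runs c Fstar_in k_gt0 w_gt0 l_lty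
  u_gtNy l_le_u oracle.
exists q, st; split=> //; first by apply: exec_if; rewrite /= S_gt0.
apply: leq_trans q_le _; rewrite mulnCA mulnC leq_mul2l mul2n -addnn -addn1.
by rewrite leq_add2l S_gt0 orbT.
Qed.
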